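(* Let $d\in\mathbb N$, $\mathcal S\subseteq\mathcal M_d$ bounded, $A\in\operatorname{conv}(\mathcal S)$ and $\epsilon>0$. Then there is a matrix $B$ with $\|A-B\|_p\le\epsilon$ which is an average $B=\frac1k\sum_{i=1}^kX_i$ of $k$ (not necessarily distinct) points $X_i\in\mathcal S$, where (a) $\displaystyle k=\Big\lceil C_p\Big(\frac{\operatorname{diam}(\mathcal S)}{\epsilon}\Big)^{\frac{p}{p-1}}\Big\rceil$ if $1<p\le4/3$; (b) $\displaystyle k=\Big\lceil D_p\Big(\frac{\operatorname{diam}(\mathcal S)}{\epsilon}\Big)^{2}\Big\rceil$ if $p=2$ or $4\le p<\infty$, with $C_p=\big(2e^2/p^{1/p}\big)^{p/(p-1)}$ and $D_p=2(p-1)e^4$. In particular $B$ is a convex combination of at most this many points of $\mathcal S$.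
   Context: $\mathcal M_d$ denotes the complex $d\times d$ matrices with the (unnormalised) Schatten $p$-norm $\|A\|_p=(\sum_i s_i(A)^p)^{1/p}$, $s_i(A)$ the singular values; $\operatorname{diam}$ is taken with respect to $\|\cdot\|_p$.
   Formalization: When diam(S)=0 (S a single point) the stated k is 0 and an average of 0 points is undefined; the formal theorem takes k as the maximum of 1 and the given ceiling, which changes nothing when diam(S)>0. The immediate closing ''in particular'' is not stated separately. *)

(* Defs.v *)
From HB Require Import structures.
From mathcomp Require Import all_boot all_order all_algebra.
From mathcomp Require Import all_classical all_reals.
From mathcomp Require Import sequences exp.
From mathcomp Require Import complex.
Set Implicit Arguments. Unset Strict Implicit. Unset Printing Implicit Defensive.
Import Order.TTheory GRing.Theory Num.Theory.
Local Open Scope ring_scope.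

Section Schatten.
Variable R : realType.
Local Notation C := R[i].

Definition adjmx (d : nat) (A : 'M[C]_d) : 'M[C]_d := (map_mx (@conjc R) A)^T.

(* s is a list of singular values of A : the eigenvalues (with algebraic
   multiplicity) of A^* A are exactly the squares of the entries of s,
   and the entries of s are nonnegative reals. *)
Definition is_sing_vals (d : nat) (A : 'M[C]_d) (s : seq R) : Prop :=
  [/\ size s = d, all (fun x => 0 <= x) s &
      char_poly (adjmx A *m A) = \prod_(x <- s) ('X - (real_complex R (x ^+ 2))%:P)].

(* the singular values s_1(A),...,s_d(A) (chosen classically; they are unique
   up to permutation, so every symmetric function of them is well defined) *)
Definition sing_vals (d : nat) (A : 'M[C]_d) : seq R :=
  xget [::] [set s | is_sing_vals A s].

Definition schatten (p : R) (d : nat) (A : 'M[C]_d) : R :=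
  powR (\sum_(x <- sing_vals A) powR x p) p^-1.

Definition sbounded (p : R) (d : nat) (S : set 'M[C]_d) : Prop :=
  exists M : R, forall X, S X -> schatten p X <= M.

Definition diam (p : R) (d : nat) (S : set 'M[C]_d) : R :=
  sup [set r | exists X Y, [/\ S X, S Y & r = schatten p (X - Y)]].

Definition conv (d : nat) (S : set 'M[C]_d) : set 'M[C]_d :=
  [set A | exists (n : nat) (lam : 'I_n -> R) (X : 'I_n -> 'M[C]_d),
      [/\ (forall i, 0 <= lam i), \sum_(i < n) lam i = 1, (forall i, S (X i)) &
          A = \sum_(i < n) real_complex R (lam i) *: X i]].

Definition approx_by_avg (p : R) (d : nat) (S : set 'M[C]_d) (A : 'M[C]_d)
    (eps : R) (k : nat) : Prop :=
  exists X : 'I_k -> 'M[C]_d, (forall i, S (X i)) /\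
    schatten p (A - real_complex R (k%:R^-1) *: \sum_(i < k) X i) <= eps.

Definition nceil (x : R) : nat := maxn 1 `|Num.ceil x|%N.

Definition Cp (p : R) : R := powR (2 * expR 1 ^+ 2 / powR p p^-1) (p / (p - 1)).
Definition Dp (p : R) : R := 2 * (p - 1) * expR 1 ^+ 4.

End Schatten.

(* Main.v *)
Require Import Defs.
From HB Require Import structures.
From mathcomp Require Import all_boot all_order all_algebra.
From mathcomp Require Import all_classical all_reals.
From mathcomp Require Import sequences exp.
From mathcomp Require Import complex spectral ring lra.
Import Order.TTheory GRing.Theory Num.Theory.
Local Open Scope ring_scope.

(** The points X_i are chosen greedily, one at a time. Passing to the Hermitian
    dilation [[0, X], [X^*, 0]], whose eigenvalues are the singular values of X
    with both signs, everything reduces to the trace power Tr |H|^p of Hermitian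
    matrices. Suppose H is the sum of the deviations X_i - A chosen so far; the
    next deviation Y ranges over a family with weighted mean 0.

    For p < 2, Clarkson's inequality Tr |H+Y|^p + Tr |H-Y|^p <= 2 Tr |H|^p + 2 Tr |Y|^p
    and convexity show that some Y adds at most 2 diam^p to Tr |H|^p.

    For p >= 2, a Y on which the derivative of Tr |.|^p at H is nonpositive adds only
    a second-order term to Tr |H|^p, so that the square of the norm grows by at most
    a multiple of (p-1) diam^2.

    The trace inequalities are scalar inequalities averaged over the doubly
    stochastic weights |<u_i, v_j>|^2 of two eigenbases. *)

(** * Scalar power inequalities: Jensen, Hölder, and the second-order remainder of |x|^p *)

Section ScalarInequalities.
Set Implicit Arguments. Unset Strict Implicit. Unset Printing Implicit Defensive.
Variable R : realType.

Lemma ler_powR2r (r x y : R) :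
  0 <= r -> 0 <= x -> x <= y -> x `^ r <= y `^ r.
Proof. by move=> r0 x0 xy; apply: ge0_ler_powR; rewrite ?nnegrE // (le_trans x0). Qed.

Lemma powRVK (r x : R) : r != 0 -> 0 <= x -> (x `^ r^-1) `^ r = x.
Proof. by move=> r0 x0; rewrite -powRrM mulVf // powRr1. Qed.

Lemma powRKV (r x : R) : r != 0 -> 0 <= x -> (x `^ r) `^ r^-1 = x.
Proof. by move=> r0 x0; rewrite -powRrM mulfV // powRr1. Qed.

(** Young's inequality for [x] and y^(q-1), with exponents q and q/(q-1): the convex function t^q
    lies above its tangent at [y]. *)
Lemma powR_tangent (q x y : R) : 1 <= q -> 0 <= x -> 0 <= y ->
  q * (x * y `^ (q - 1)) <= x `^ q + (q - 1) * y `^ q.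
Proof.
rewrite le_eqVlt => /predU1P[<- x0 y0|q1 x0 y0].
  by rewrite subrr powRr0 powRr1 // mul0r addr0 mulr1 mul1r.
have q0 : 0 < q by lra.
have q10 : 0 < q - 1 by lra.
have := @conjugate_powR R x (y `^ (q - 1)) q (q / (q - 1)) x0 (powR_ge0 _ _) q0.
rewrite divr_gt0 // => /(_ isT).
have -> : q^-1 + (q / (q - 1))^-1 = 1 by field; rewrite !gt_eqF.
move=> /(_ erefl).
rewrite -powRrM mulrCA mulfV ?gt_eqF // mulr1 => h.
rewrite -ler_pdivlMl //; apply: le_trans h _.
by rewrite le_eqVlt; apply/orP; left; apply/eqP; field; rewrite !gt_eqF.
Qed.

(** Averages the tangent inequality at the mean [m]. *)
Lemma jensen_powR (I : finType) (w x : I -> R) (q : R) : 1 <= q ->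
  (forall i, 0 <= w i) -> \sum_i w i = 1 -> (forall i, 0 <= x i) ->
  (\sum_i w i * x i) `^ q <= \sum_i w i * x i `^ q.
Proof.
move=> q1 w0 w1 x0; set m := \sum_i w i * x i.
have m0 : 0 <= m by apply: sumr_ge0 => i _; rewrite mulr_ge0.
have : \sum_i w i * (q * (x i * m `^ (q - 1))) <=
       \sum_i w i * (x i `^ q + (q - 1) * m `^ q).
  by apply: ler_sum => i _; apply: ler_wpM2l => //; exact: powR_tangent.
under [X in _ <= X]eq_bigr do rewrite mulrDr.
rewrite big_split /= -mulr_suml w1 mul1r.
have -> : \sum_i w i * (q * (x i * m `^ (q - 1))) = q * (m * m `^ (q - 1)).
  rewrite /m mulr_suml mulr_sumr; apply: eq_bigr => i _; ring.
rewrite mulr_powRB1 //; lra.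
Qed.

Lemma jensen_powR_concave (I : finType) (w x : I -> R) (s : R) :
  0 < s -> s <= 1 ->
  (forall i, 0 <= w i) -> \sum_i w i = 1 -> (forall i, 0 <= x i) ->
  \sum_i w i * x i `^ s <= (\sum_i w i * x i) `^ s.
Proof.
move=> s0 s1 w0 w1 x0.
have sn0 : s != 0 by rewrite gt_eqF.
have q1 : 1 <= s^-1 by rewrite invf_ge1.
have := @jensen_powR I w (fun i => x i `^ s) s^-1 q1 w0 w1 (fun i => powR_ge0 _ _).
under [X in _ <= X]eq_bigr do rewrite powRKV //.
have t0 : 0 <= \sum_i w i * x i `^ s.
  by apply: sumr_ge0 => i _; rewrite mulr_ge0 // powR_ge0.
by move=> /(ler_powR2r (ltW s0) (powR_ge0 _ _)); rewrite powRVK.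
Qed.

(** The tangent inequality for t^(p/2) at x^2, scaled by 2/p; this form includes p = 2, where
    p/(p-2) is undefined. *)
Lemma young_weighted (p x y : R) : 2 <= p -> 0 <= x -> 0 <= y ->
  x `^ (p - 2) * y <= (p - 2) / p * x `^ p + 2 / p * y `^ (p / 2).
Proof.
move=> p2 x0 y0.
have p0 : p != 0 by rewrite gt_eqF //; lra.
have q1 : 1 <= p / 2 by lra.
have := powR_tangent q1 y0 (powR_ge0 x 2).
rewrite -!powRrM.
have -> : 2 * (p / 2 - 1) = p - 2 by field.
have -> : 2 * (p / 2) = p by field.
move=> h.
have p20 : 0 <= 2 / p by rewrite divr_ge0 //; lra.
have := ler_wpM2l p20 h.
have -> : 2 / p * (p / 2 * (y * x `^ (p - 2))) = x `^ (p - 2) * y by field.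
have -> : 2 / p * (y `^ (p / 2) + (p / 2 - 1) * x `^ p) =
  (p - 2) / p * x `^ p + 2 / p * y `^ (p / 2) by field.
by [].
Qed.

(** Hölder with exponents p/(p-2) and p/2: after division by [a] and [b ^+ 2], [young_weighted] is
    summed termwise, and its coefficients add to 1. *)
Lemma holder_powR (I : finType) (p a b : R) (x y : I -> R) : 2 <= p ->
  0 < a -> 0 < b -> (forall i, 0 <= x i) -> (forall i, 0 <= y i) ->
  \sum_i x i `^ p <= a `^ p -> \sum_i y i `^ (p / 2) <= b `^ p ->
  \sum_i x i `^ (p - 2) * y i <= a `^ (p - 2) * b ^+ 2.
Proof.
move=> p2 a0 b0 x0 y0 hx hy.
have p0 : 0 < p by lra.
have b20 : 0 < b ^+ 2 by rewrite exprn_gt0.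
have ap0 := powR_gt0 p a0; have bp0 := powR_gt0 p b0; have ap20 := powR_gt0 (p - 2) a0.
have xE i : x i = x i / a * a by rewrite divfK ?gt_eqF.
have yE i : y i = y i / b ^+ 2 * b ^+ 2 by rewrite divfK ?gt_eqF.
have xa0 i : 0 <= x i / a by rewrite divr_ge0 // ltW.
have yb0 i : 0 <= y i / b ^+ 2 by rewrite divr_ge0 // ltW.
have hx' : \sum_i (x i / a) `^ p <= 1.
  rewrite -(ler_pM2r ap0) mul1r mulr_suml; apply: le_trans hx.
  by apply: ler_sum => i _; rewrite -powRM // ?divfK ?gt_eqF // ltW.
have b2p : (b ^+ 2) `^ (p / 2) = b `^ p.
  by rewrite -powR_mulrn ?ltW // -powRrM; congr (_ `^ _); field.
have hy' : \sum_i (y i / b ^+ 2) `^ (p / 2) <= 1.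
  rewrite -(ler_pM2r bp0) mul1r mulr_suml; apply: le_trans hy.
  by apply: ler_sum => i _; rewrite -b2p -powRM // ?divfK ?gt_eqF // ltW.
have h : \sum_i (x i / a) `^ (p - 2) * (y i / b ^+ 2) <= 1.
  have : \sum_i (x i / a) `^ (p - 2) * (y i / b ^+ 2) <=
     \sum_i ((p - 2) / p * (x i / a) `^ p + 2 / p * (y i / b ^+ 2) `^ (p / 2)).
    by apply: ler_sum => i _; exact: young_weighted.
  rewrite big_split /= -!mulr_sumr => /le_trans; apply.
  rewrite [leRHS](_ : _ = (p - 2) / p * 1 + 2 / p * 1); last by field; rewrite gt_eqF.
  by apply: lerD; apply: ler_wpM2l => //; rewrite divr_ge0 //; lra.
have ab0 : 0 < a `^ (p - 2) * b ^+ 2 by rewrite mulr_gt0.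
rewrite -[leRHS]mul1r; apply: le_trans (ler_wpM2r (ltW ab0) h).
rewrite mulr_suml; apply: ler_sum => i _.
rewrite mulrACA -powRM ?(ltW a0) //.
by rewrite !divfK ?gt_eqF.
Qed.

(** Odd extension of t^q: for p > 1 the derivative of |x|^p is p times [spow (p - 1) x]. *)
Definition spow (q x : R) : R := Num.sg x * `|x| `^ q.

Lemma spowN (q x : R) : spow q (- x) = - spow q x.
Proof. by rewrite /spow sgrN normrN mulNr. Qed.

Lemma spow_ge0 (q x : R) : 0 < q -> 0 <= x -> spow q x = x `^ q.
Proof.
move=> q0; rewrite le_eqVlt => /predU1P[<-|x0].
  by rewrite /spow sgr0 mul0r powR0 // gt_eqF.
by rewrite /spow gtr0_sg // mul1r gtr0_norm.
Qed.

Lemma abs_powR_tangent (q x y : R) : 1 < q ->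
  `|y| `^ q + q * (spow (q - 1) y * (x - y)) <= `|x| `^ q.
Proof.
move=> q1.
wlog y0 : x y / 0 <= y => [hw|].
  have [y0|/ltW y0] := leP 0 y; first exact: hw.
  have := hw (- x) (- y); rewrite oppr_ge0 y0 => /(_ isT).
  rewrite !normrN spowN; congr (_ + _ * _ <= _); ring.
rewrite spow_ge0 ?subr_gt0 // (ger0_norm y0) mulrBr [_ * y]mulrC mulr_powRB1 //; last lra.
have := powR_tangent (ltW q1) (normr_ge0 x) y0.
have : x * y `^ (q - 1) <= `|x| * y `^ (q - 1).
  by apply: ler_wpM2r (ler_norm _); exact: powR_ge0.
move: (q1); set A := `|x| * _; set B := y `^ q; set D := `|x| `^ q; set E := x * _; rewrite [_ * x]mulrC -/E.
by nra.
Qed.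

Lemma powRB2 (p x : R) : 1 < p -> 0 <= x -> x `^ (p - 1) = x * x `^ (p - 2).
Proof.
move=> p1 x0; rewrite (_ : p - 2 = p - 1 - 1); last by ring.
by rewrite mulr_powRB1 // subr_gt0.
Qed.

(** By the tangent inequality at [x], the remainder at [y] is at most p (x - y) times the increment
    of [spow (p - 1)] from [y] to [x]. This product is bounded by cases on the signs. *)
Lemma bregman_powR (p x y : R) : 2 <= p ->
  `|x| `^ p <= `|y| `^ p + p * (spow (p - 1) y * (x - y))
    + p * (p - 1) * ((x - y) ^+ 2 * (`|x| `^ (p - 2) + `|y| `^ (p - 2))).
Proof.
move=> p2; have p1 : 1 < p by lra.
have h := abs_powR_tangent y x p1.
suff : (spow (p - 1) x - spow (p - 1) y) * (x - y) <=
    (p - 1) * ((x - y) ^+ 2 * (`|x| `^ (p - 2) + `|y| `^ (p - 2))) by nra.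
clear h.
(* Equal signs: the tangent of t^(p-1) at the larger point serves as mean value theorem. *)
have same (u v : R) : 0 <= v -> v <= u ->
    (u `^ (p - 1) - v `^ (p - 1)) * (u - v) <= (p - 1) * ((u - v) ^+ 2 * u `^ (p - 2)).
  move=> v0 vu; have u0 := le_trans v0 vu.
  have := @powR_tangent (p - 1) v u; rewrite (_ : p - 1 - 1 = p - 2); last by ring.
  move=> /(_ _ v0 u0) h; have /h{}h : 1 <= p - 1 by lra.
  have e : u * u `^ (p - 2) = u `^ (p - 1).
    by rewrite powRB2 //; lra.
  have d0 : 0 <= u - v by lra.
  have : u `^ (p - 1) - v `^ (p - 1) <= (p - 1) * (u - v) * u `^ (p - 2) by nra.
  by move=> /(ler_wpM2r d0) /le_trans; apply; rewrite le_eqVlt; apply/orP; left; apply/eqP; ring.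
(* Opposite signs: u and v are each at most the distance u + v, and p - 1 >= 1. *)
have opp (u v : R) : 0 <= u -> 0 <= v ->
    (u `^ (p - 1) + v `^ (p - 1)) * (u + v) <=
    (p - 1) * ((u + v) ^+ 2 * (u `^ (p - 2) + v `^ (p - 2))).
  move=> u0 v0.
  have eu : u `^ (p - 1) = u * u `^ (p - 2).
    by rewrite powRB2 //; lra.
  have ev : v `^ (p - 1) = v * v `^ (p - 2).
    by rewrite powRB2 //; lra.
  have U := powR_ge0 u (p - 2); have V := powR_ge0 v (p - 2).
  rewrite eu ev; move: (u `^ _) (v `^ _) U V => A B A0 B0.
  have : (u * A + v * B) * (u + v) <= (u + v) ^+ 2 * (A + B).
    rewrite expr2 [leRHS]mulrAC; apply: ler_wpM2r; first lra.
    nra.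
  move=> /le_trans; apply; rewrite ler_peMl //; last lra.
  by rewrite mulr_ge0 // ?sqr_ge0 //; lra.
have both (u v : R) : 0 <= u -> 0 <= v ->
    (u `^ (p - 1) - v `^ (p - 1)) * (u - v) <=
    (p - 1) * ((u - v) ^+ 2 * (u `^ (p - 2) + v `^ (p - 2))).
  move=> u0 v0; have U := powR_ge0 u (p - 2); have V := powR_ge0 v (p - 2).
  have q0 : 0 <= (p - 1) * (u - v) ^+ 2 by rewrite mulr_ge0 ?sqr_ge0 //; lra.
  have := ler_wpM2l q0 U; have := ler_wpM2l q0 V; rewrite !mulr0 => hV hU.
  have [vu|/ltW uv] := leP v u; first by have := same _ _ v0 vu; nra.
  have := same _ _ u0 uv.
  by rewrite -(sqrrN (v - u)) opprB; nra.
have p10 : 0 < p - 1 by lra.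
have spow_le0 z : z <= 0 -> spow (p - 1) z = - (- z) `^ (p - 1).
  by move=> z0; rewrite -spow_ge0 ?oppr_ge0 // spowN opprK.
have [x0|/ltW x0] := leP 0 x; have [y0|/ltW y0] := leP 0 y.
- by rewrite !spow_ge0 // !ger0_norm //; exact: both.
- have ny : 0 <= - y by rewrite oppr_ge0.
  have := opp _ _ x0 ny.
  by rewrite (spow_le0 y) // spow_ge0 // ger0_norm // ler0_norm // opprK.
- have nx : 0 <= - x by rewrite oppr_ge0.
  have := opp _ _ nx y0.
  rewrite (spow_le0 x) // spow_ge0 // ler0_norm // ger0_norm //.
  by rewrite (_ : (- x + y) ^+ 2 = (x - y) ^+ 2); [nra | ring].
- have nx : 0 <= - x by rewrite oppr_ge0.
  have ny : 0 <= - y by rewrite oppr_ge0.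
  have := both _ _ nx ny.
  rewrite (spow_le0 x) // (spow_le0 y) // !ler0_norm //.
  by rewrite (_ : (- x - - y) ^+ 2 = (x - y) ^+ 2); [nra | ring].
Qed.

(** The averaging argument behind each greedy choice. *)
Lemma ex_le_weighted_mean (I : finType) (w x : I -> R) (c : R) :
  (forall i, 0 <= w i) -> \sum_i w i = 1 -> \sum_i w i * x i <= c -> exists i, x i <= c.
Proof.
move=> w0 w1 h; have [//|/forallNP nx] := pselect (exists i, x i <= c).
have xc i : c < x i by rewrite ltNge; apply/negP/nx.
have [/existsP[i wi]|/existsPn wn] := boolP [exists i, 0 < w i]; last first.
  suff /eqP : \sum_i w i = 0 by rewrite w1 oner_eq0.
  by apply: big1 => i _; apply/eqP; rewrite eq_le w0 leNgt wn.
suff : c < \sum_i w i * x i by rewrite ltNge h.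
rewrite -[ltLHS]mul1r -w1 mulr_suml (bigD1 i) //= [ltRHS](bigD1 i) //=.
apply: ltr_leD; first by rewrite ltr_pM2l.
by apply: ler_sum => j _; rewrite ler_wpM2l ?w0 ?ltW.
Qed.

End ScalarInequalities.

(** * Eigenbases, quadratic forms and overlap weights *)

Section Spectra.
Set Implicit Arguments. Unset Strict Implicit. Unset Printing Implicit Defensive.
Variable R : realType.
Local Notation C := R[i].
Local Notation "x %:C" := (real_complex R x).

Definition ctr m n (A : 'M[C]_(m, n)) : 'M[C]_(n, m) := (map_mx (@conjc R) A)^T.
Definition sqn (z : C) : R := complex.Re z ^+ 2 + complex.Im z ^+ 2.

Lemma mulCconjc (z : C) : z * conjc z = (sqn z)%:C.
Proof. by case: z => a b; apply/eqP; rewrite eq_complex /= /sqn /=; apply/andP; split; apply/eqP; ring. Qed.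

Lemma sqn_ge0 z : 0 <= sqn z. Proof. by rewrite addr_ge0 ?sqr_ge0. Qed.
Lemma sqn_conj z : sqn (conjc z) = sqn z. Proof. by case: z => a b; rewrite /sqn /= sqrrN. Qed.
Lemma sqnM_real (x : R) z : sqn (x%:C * z) = x ^+ 2 * sqn z.
Proof. by case: z => a b; rewrite /sqn /=; ring. Qed.
Lemma sqn_real (x : R) : sqn x%:C = x ^+ 2.
Proof. by rewrite /sqn /= expr0n addr0. Qed.

Lemma Re_sum I (r : seq I) (P : pred I) (F : I -> C) :
  complex.Re (\sum_(i <- r | P i) F i) = \sum_(i <- r | P i) complex.Re (F i).
Proof. by rewrite raddf_sum. Qed.

Lemma ctrK m n (A : 'M[C]_(m, n)) : ctr (ctr A) = A.
Proof. by apply/matrixP => i j; rewrite !mxE conjcK. Qed.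
Lemma ctrM m n k (A : 'M[C]_(m, n)) (B : 'M[C]_(n, k)) : ctr (A *m B) = ctr B *m ctr A.
Proof. by rewrite /ctr map_mxM trmx_mul. Qed.
Lemma ctrD m n (A B : 'M[C]_(m, n)) : ctr (A + B) = ctr A + ctr B.
Proof. by apply/matrixP => i j; rewrite !mxE rmorphD. Qed.
Lemma ctrN m n (A : 'M[C]_(m, n)) : ctr (- A) = - ctr A.
Proof. by apply/matrixP => i j; rewrite !mxE rmorphN. Qed.
Lemma ctrB m n (A B : 'M[C]_(m, n)) : ctr (A - B) = ctr A - ctr B.
Proof. by rewrite ctrD ctrN. Qed.
Lemma ctrZ m n (x : R) (A : 'M[C]_(m, n)) : ctr (x%:C *: A) = x%:C *: ctr A.
Proof. by apply/matrixP => i j; rewrite !mxE rmorphM /= oppr0. Qed.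
Lemma ctr_sum m n I (r : seq I) (P : pred I) (F : I -> 'M[C]_(m, n)) :
  ctr (\sum_(i <- r | P i) F i) = \sum_(i <- r | P i) ctr (F i).
Proof.
apply: (big_morph (@ctr m n)) => [A B|]; first exact: ctrD.
by apply/matrixP => i j; rewrite !mxE rmorph0.
Qed.

Definition rdiag n (lam : 'I_n -> R) : 'M[C]_n := diag_mx (\row_j (lam j)%:C).

Lemma ctr_rdiag n (lam : 'I_n -> R) : ctr (rdiag lam) = rdiag lam.
Proof.
apply/matrixP => i j; rewrite !mxE eq_sym; case: eqP => [->|_].
  by rewrite !mulr1n /= oppr0.
by rewrite !mulr0n rmorph0.
Qed.

Lemma mul_rdiag n (lam mu : 'I_n -> R) :
  rdiag lam *m rdiag mu = rdiag (fun i => lam i * mu i).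
Proof.
rewrite /rdiag mulmx_diag; congr diag_mx; apply/rowP => j.
by rewrite !mxE rmorphM.
Qed.

(** The eigenvectors are the adjoints of the rows of the unitary [V]. Any eigenbasis is allowed, so
    one [V] serves both [H] and [H *m H]. *)
Definition eigdec n (H V : 'M[C]_n) (lam : 'I_n -> R) :=
  [/\ V *m ctr V = 1%:M, ctr V *m V = 1%:M & H = ctr V *m rdiag lam *m V].

(** The quadratic form of [H] at row i of [Z]; it is real for Hermitian [H]. A rectangular [Z]
    allows a single test vector. *)
Definition diagval m n (Z : 'M[C]_(m, n)) (H : 'M[C]_n) (i : 'I_m) : R :=
  complex.Re ((Z *m H *m ctr Z) i i).

(** The weights |<z_i, v_j>|^2, doubly stochastic when [Z] and [V] are unitary. *)
Definition overlap m n k (Z : 'M[C]_(m, n)) (V : 'M[C]_(k, n)) i j : R :=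
  sqn ((Z *m ctr V) i j).

Lemma overlap_ge0 m n k (Z : 'M[C]_(m, n)) (V : 'M[C]_(k, n)) i j : 0 <= overlap Z V i j.
Proof. exact: sqn_ge0. Qed.

Lemma overlapC m n k (Z : 'M[C]_(m, n)) (V : 'M[C]_(k, n)) i j :
  overlap Z V i j = overlap V Z j i.
Proof.
have -> : overlap V Z j i = sqn (ctr (Z *m ctr V) j i) by rewrite ctrM ctrK.
by rewrite /overlap !mxE sqn_conj.
Qed.

Lemma mulmx_ctr_diag m n (A : 'M[C]_(m, n)) i :
  (A *m ctr A) i i = (\sum_j sqn (A i j))%:C.
Proof.
rewrite mxE rmorph_sum; apply: eq_bigr => j _.
by rewrite !mxE mulCconjc.
Qed.

Lemma overlap_row m n k (Z : 'M[C]_(m, n)) (V : 'M[C]_(k, n)) i :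
  Z *m ctr Z = 1%:M -> ctr V *m V = 1%:M -> \sum_j overlap Z V i j = 1.
Proof.
move=> ZZ VV; have := mulmx_ctr_diag (Z *m ctr V) i.
rewrite ctrM ctrK mulmxA -(mulmxA Z) VV mulmx1 ZZ mxE eqxx mulr1n.
by move=> /(congr1 (@complex.Re R)) /= <-.
Qed.

Lemma overlap_col m n k (Z : 'M[C]_(m, n)) (V : 'M[C]_(k, n)) j :
  ctr Z *m Z = 1%:M -> V *m ctr V = 1%:M -> \sum_i overlap Z V i j = 1.
Proof.
move=> ZZ VV; under eq_bigr do rewrite overlapC.
exact: overlap_row.
Qed.

Lemma diagvalD m n (Z : 'M[C]_(m, n)) H K i :
  diagval Z (H + K) i = diagval Z H i + diagval Z K i.
Proof. by rewrite /diagval mulmxDr mulmxDl mxE raddfD. Qed.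

Lemma diagvalZ m n (Z : 'M[C]_(m, n)) (x : R) H i :
  diagval Z (x%:C *: H) i = x * diagval Z H i.
Proof.
rewrite /diagval -scalemxAr -scalemxAl mxE.
by case: (_ i i) => a b /=; rewrite mul0r subr0.
Qed.

Lemma diagval_sum m n (Z : 'M[C]_(m, n)) I (r : seq I) (P : pred I) F i :
  diagval Z (\sum_(j <- r | P j) F j) i = \sum_(j <- r | P j) diagval Z (F j) i.
Proof.
apply: (big_morph (fun H => diagval Z H i)) => [A B|]; first exact: diagvalD.
by rewrite /diagval mulmx0 mul0mx mxE.
Qed.

Lemma diagvalB m n (Z : 'M[C]_(m, n)) H K i :
  diagval Z (H - K) i = diagval Z H i - diagval Z K i.
Proof. by have := diagvalD Z (H - K) K i; rewrite subrK => ->; rewrite addrK. Qed.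

Lemma diagval_gram m n k (Z : 'M[C]_(m, n)) (B : 'M[C]_(n, k)) i :
  diagval Z (B *m ctr B) i = \sum_j sqn ((Z *m B) i j).
Proof.
by rewrite /diagval mulmxA -(mulmxA (Z *m B)) -ctrM mulmx_ctr_diag.
Qed.

Lemma diagval_eig m n (Z : 'M[C]_(m, n)) (H V : 'M[C]_n) lam i : eigdec H V lam ->
  diagval Z H i = \sum_j overlap Z V i j * lam j.
Proof.
move=> [_ _ ->]; rewrite /diagval.
have -> : Z *m (ctr V *m rdiag lam *m V) *m ctr Z =
   (Z *m ctr V) *m rdiag lam *m ctr (Z *m ctr V) by rewrite ctrM ctrK !mulmxA.
rewrite /overlap; move: (Z *m ctr V) => T.
rewrite mxE Re_sum; apply: eq_bigr => j _.
rewrite mul_mx_diag !mxE -mulrA [_ * conjc _]mulrC mulrA mulCconjc -rmorphM /=.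
by [].
Qed.

Lemma eig_conj n (H V : 'M[C]_n) lam : eigdec H V lam -> V *m H *m ctr V = rdiag lam.
Proof. by move=> [V1 V2 ->]; rewrite !mulmxA V1 mul1mx -mulmxA V1 mulmx1. Qed.

Lemma diagval_self n (H V : 'M[C]_n) lam i : eigdec H V lam -> diagval V H i = lam i.
Proof. by move=> /eig_conj; rewrite /diagval => ->; rewrite !mxE eqxx mulr1n. Qed.

Lemma eigdec_herm n (H V : 'M[C]_n) lam : eigdec H V lam -> ctr H = H.
Proof. by move=> [_ _ ->]; rewrite !ctrM ctrK ctr_rdiag mulmxA. Qed.

Lemma eigdec_sq n (H V : 'M[C]_n) lam : eigdec H V lam ->
  eigdec (H *m H) V (fun i => lam i ^+ 2).
Proof.
move=> [V1 V2 ->]; split=> //.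
rewrite !mulmxA -[ctr V *m rdiag lam *m V *m ctr V]mulmxA V1 mulmx1.
by rewrite -[ctr V *m rdiag lam *m rdiag lam]mulmxA mul_rdiag.
Qed.

(** Between the two bases B - A has entries T_ij (be_j - al_i), where T is [U *m ctr V]; the left
    side is the squared length of row i. *)
Lemma eigdec_diff n (A U B V : 'M[C]_n) al be i : eigdec A U al -> eigdec B V be ->
  diagval U ((B - A) *m (B - A)) i = \sum_j overlap U V i j * (be j - al i) ^+ 2.
Proof.
move=> eA eB; have [U1 U2 EA] := eA; have [V1 V2 EB] := eB.
have hK : ctr (B - A) = B - A by rewrite ctrB (eigdec_herm eA) (eigdec_herm eB).
have -> : (B - A) *m (B - A) = ((B - A) *m ctr V) *m ctr ((B - A) *m ctr V).
  by rewrite ctrM ctrK hK mulmxA -(mulmxA _ _ V) V2 mulmx1.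
rewrite diagval_gram; apply: eq_bigr => j _.
have -> : U *m ((B - A) *m ctr V) = (U *m ctr V) *m rdiag be - rdiag al *m (U *m ctr V).
  rewrite mulmxBl mulmxBr; congr (_ - _).
    by rewrite EB -!mulmxA V1 mulmx1.
  by rewrite EA !mulmxA U1 mul1mx.
rewrite /overlap; move: (U *m ctr V) => T.
rewrite mul_mx_diag mul_diag_mx !mxE [T i j * _]mulrC -mulrBl -rmorphB sqnM_real.
by rewrite mulrC.
Qed.

Lemma eigdec_exists n (H : 'M[C]_n) : ctr H = H ->
  eigdec H (spectralmx H) (fun i => complex.Re (spectral_diag H 0 i)).
Proof.
move=> hH; have cE m k (A : 'M[C]_(m, k)) : map_mx Num.conj A^T = ctr A.
  by apply/matrixP => i j; rewrite !mxE.
have herm : H \is hermsymmx.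
  by apply/is_hermitianmxP; rewrite expr0 scale1r cE hH.
have /hermitian_normalmx /orthomx_spectralP HE := herm.
have uP := spectral_unitarymx H; have uU := unitarymx_unit uP.
have iE : invmx (spectralmx H) = ctr (spectralmx H) by rewrite invmx_unitary // cE.
split; first by rewrite -iE mulmxV.
  by rewrite -iE mulVmx.
rewrite {1}HE iE; congr (_ *m diag_mx _ *m _); apply/rowP => j; rewrite !mxE.
have /mxOverP/(_ 0 j) := hermitian_spectral_diag_real herm.
by move=> /Creal_ReP; case: (_ 0 j) => a b; rewrite -complexRe /= => [] [] <-.
Qed.

Section Peierls.
Variables (n : nat) (H V U : 'M[C]_n) (lam : 'I_n -> R).
Hypotheses (eH : eigdec H V lam) (U1 : U *m ctr U = 1%:M) (U2 : ctr U *m U = 1%:M).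

(** The diagonal of [H] in the basis [U] is a doubly stochastic image of the eigenvalues: row sums 1
    allow Jensen, column sums 1 then remove the weights. *)
Lemma peierls_powR (p : R) : 1 <= p ->
  \sum_i `|diagval U H i| `^ p <= \sum_j `|lam j| `^ p.
Proof.
move=> p1; have [V1 V2 _] := eH.
apply: (@le_trans _ _ (\sum_i \sum_j overlap U V i j * `|lam j| `^ p)).
  apply: ler_sum => i _; rewrite (diagval_eig _ _ eH).
  apply: le_trans (jensen_powR p1 (overlap_ge0 U V i) (overlap_row i U1 V2) (fun j => normr_ge0 (lam j))).
  apply: ler_powR2r; rewrite ?normr_ge0 //; first lra.
  apply: le_trans (ler_norm_sum _ _ _) _; apply: ler_sum => j _.
  by rewrite normrM (ger0_norm (overlap_ge0 _ _ _ _)).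
rewrite exchange_big /=; apply: ler_sum => j _.
by rewrite -mulr_suml overlap_col // mul1r.
Qed.

Lemma peierls_powR_concave (s : R) : 0 < s -> s <= 1 -> (forall j, 0 <= lam j) ->
  \sum_j lam j `^ s <= \sum_i diagval U H i `^ s.
Proof.
move=> s0 s1 l0; have [V1 V2 _] := eH.
apply: (@le_trans _ _ (\sum_i \sum_j overlap U V i j * lam j `^ s)); last first.
  apply: ler_sum => i _; rewrite (diagval_eig _ _ eH).
  by apply: jensen_powR_concave => //; [move=> j; exact: overlap_ge0 | exact: overlap_row].
rewrite exchange_big /=; apply: ler_sum => j _.
by rewrite -mulr_suml overlap_col // mul1r.
Qed.

End Peierls.

End Spectra.

(** * Hermitian matrices and their eigenvalues *)

Section HermitianMatrices.
Set Implicit Arguments. Unset Strict Implicit. Unset Printing Implicit Defensive.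
Variable R : realType.
Local Notation C := R[i].
Local Notation "x %:C" := (real_complex R x).

Definition herm n (H : 'M[C]_n) := ctr H = H.

Lemma hermD n (H K : 'M[C]_n) : herm H -> herm K -> herm (H + K).
Proof. by rewrite /herm ctrD => -> ->. Qed.
Lemma hermB n (H K : 'M[C]_n) : herm H -> herm K -> herm (H - K).
Proof. by rewrite /herm ctrB => -> ->. Qed.
Lemma hermZ n (x : R) (H : 'M[C]_n) : herm H -> herm (x%:C *: H).
Proof. by rewrite /herm ctrZ => ->. Qed.
Lemma herm_sq n (H : 'M[C]_n) : herm H -> herm (H *m H).
Proof. by rewrite /herm ctrM => ->. Qed.
Lemma herm_sum n I (r : seq I) (P : pred I) (F : I -> 'M[C]_n) :
  (forall i, herm (F i)) -> herm (\sum_(i <- r | P i) F i).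
Proof. by move=> hF; rewrite /herm ctr_sum; apply: eq_bigr => i _; exact: hF. Qed.

Definition eigs n (H : 'M[C]_n) (i : 'I_n) : R := complex.Re (spectral_diag H 0 i).

Lemma eigsP n (H : 'M[C]_n) : herm H -> eigdec H (spectralmx H) (eigs H).
Proof. exact: eigdec_exists. Qed.

End HermitianMatrices.

(* Locked because comparing two traces by conversion unfolds their spectral
   decompositions and does not terminate in practice. *)
HB.lock Definition trp {R : realType} (p : R) {n : nat} (H : 'M[R[i]]_n) : R :=
  \sum_i `|eigs H i| `^ p.

(** * Trace powers: convexity, triangle, Rotfel'd and Clarkson inequalities *)

Section TracePowers.
Set Implicit Arguments. Unset Strict Implicit. Unset Printing Implicit Defensive.
Variable R : realType.
Local Notation C := R[i].
Local Notation "x %:C" := (real_complex R x).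

Lemma trp_ge0 p n (H : 'M[C]_n) : 0 <= trp p H.
Proof. by rewrite trp.unlock; apply: sumr_ge0 => i _; exact: powR_ge0. Qed.

(** Independence of the eigenbasis: Peierls' inequality in each of the two eigenbases gives both
    bounds, with no matching of eigenvalues. *)
Lemma trp_eig p n (H V : 'M[C]_n) lam : 1 <= p -> eigdec H V lam ->
  \sum_i `|lam i| `^ p = trp p H.
Proof.
move=> p1 eH; have eH' := eigsP (eigdec_herm eH).
have [V1 V2 _] := eH; have [W1 W2 _] := eH'.
rewrite trp.unlock; apply/eqP; rewrite eq_le; apply/andP; split.
  apply: le_trans (peierls_powR eH' V1 V2 p1).
  by apply: ler_sum => i _; rewrite (diagval_self _ eH).
apply: le_trans (peierls_powR eH W1 W2 p1).
by apply: ler_sum => i _; rewrite (diagval_self _ eH').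
Qed.

(** In the eigenbasis of the mean, its eigenvalues are means of diagonal entries of the [F i];
    scalar Jensen applies, then Peierls for each [F i]. *)
Lemma trp_convex p n (I : finType) (w : I -> R) (F : I -> 'M[C]_n) : 1 <= p ->
  (forall i, 0 <= w i) -> \sum_i w i = 1 -> (forall i, herm (F i)) ->
  trp p (\sum_i (w i)%:C *: F i) <= \sum_i w i * trp p (F i).
Proof.
move=> p1 w0 w1 hF; set H := \sum_i _; rewrite trp.unlock.
have hH : herm H by apply: herm_sum => i; exact: hermZ.
have eH := eigsP hH; have [V1 V2 _] := eH.
apply: (@le_trans _ _ (\sum_k \sum_i w i * `|diagval (spectralmx H) (F i) k| `^ p)).
  apply: ler_sum => k _; rewrite -(diagval_self k eH) {2}/H diagval_sum.
  apply: le_trans (jensen_powR p1 w0 w1 (fun i => normr_ge0 (diagval (spectralmx H) (F i) k))).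
  apply: ler_powR2r; rewrite ?normr_ge0 //; first lra.
  apply: le_trans (ler_norm_sum _ _ _) _; apply: ler_sum => j _.
  by rewrite diagvalZ normrM (ger0_norm (w0 j)).
rewrite exchange_big /=; apply: ler_sum => i _; rewrite -mulr_sumr.
apply: ler_wpM2l => //; exact: (peierls_powR (eigsP (hF i)) V1 V2 p1).
Qed.

Lemma trpZ p n (x : R) (H : 'M[C]_n) : 1 <= p -> herm H ->
  trp p (x%:C *: H) = `|x| `^ p * trp p H.
Proof.
move=> p1 hH; have [V1 V2 HE] := eigsP hH.
have e : eigdec (x%:C *: H) (spectralmx H) (fun i => x * eigs H i).
  split=> //; rewrite {1}HE scalemxAl scalemxAr; congr (_ *m _ *m _).
  apply/matrixP => i j; rewrite !mxE rmorphM /=.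
  by rewrite mulrnAr.
rewrite -(trp_eig p1 e) trp.unlock mulr_sumr; apply: eq_bigr => i _.
by rewrite normrM powRM.
Qed.

(** A + B is the mean of ((a+b)/a) A and ((a+b)/b) B with weights a/(a+b) and b/(a+b), and both have
    trace power at most (a+b)^p. *)
Lemma trp_triangle p n (A B : 'M[C]_n) a b : 1 <= p -> herm A -> herm B ->
  0 < a -> 0 < b -> trp p A <= a `^ p -> trp p B <= b `^ p -> trp p (A + B) <= (a + b) `^ p.
Proof.
move=> p1 hA hB a0 b0 Aa Bb; have ab0 : 0 < a + b by rewrite addr_gt0.
pose w (t : bool) := if t then a / (a + b) else b / (a + b).
pose F (t : bool) := if t then ((a + b) / a)%:C *: A else ((a + b) / b)%:C *: B.
have nz : [&& a != 0, b != 0 & a + b != 0] by rewrite !gt_eqF.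
case/and3P: nz => an bn abn.
have FE : \sum_t (w t)%:C *: F t = A + B.
  rewrite big_bool /= !scalerA -!rmorphM /=.
  rewrite (_ : a / (a + b) * ((a + b) / a) = 1); last by field; rewrite ?an ?bn ?abn.
  rewrite (_ : b / (a + b) * ((a + b) / b) = 1); last by field; rewrite ?an ?bn ?abn.
  by rewrite !scale1r.
have w0 t : 0 <= w t by case: t => /=; rewrite divr_ge0 // ltW.
have w1 : \sum_t w t = 1 by rewrite big_bool /= -mulrDl divff.
have hF t : herm (F t) by case: t; exact: hermZ.
have := trp_convex p1 w0 w1 hF; rewrite FE big_bool /= => /le_trans; apply.
have pab x : 0 < x -> 0 <= (a + b) / x by move=> x0; rewrite divr_ge0 // ltW.
rewrite !trpZ // !(ger0_norm (pab _ _)) //.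
have bnd x X : 0 < x -> X <= x `^ p -> ((a + b) / x) `^ p * X <= (a + b) `^ p.
  move=> x0 Xx; rewrite [leRHS](_ : _ = ((a + b) / x) `^ p * x `^ p).
    by apply: ler_wpM2l => //; exact: powR_ge0.
  by rewrite -powRM ?pab ?(ltW x0) // divfK // gt_eqF.
rewrite -[leRHS]mul1r -w1 big_bool /= [leRHS]mulrDl; apply: lerD.
  by rewrite ler_wpM2l ?bnd // divr_ge0 // ltW.
by rewrite ler_wpM2l ?bnd // divr_ge0 // ltW.
Qed.

Lemma sq_psd m n (V : 'M[C]_(m, n)) (H : 'M[C]_n) k : herm H -> 0 <= diagval V (H *m H) k.
Proof.
move=> hH; rewrite -[X in _ *m X]hH diagval_gram; apply: sumr_ge0 => j _; exact: sqn_ge0.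
Qed.

Lemma abs_powR_sq (p x : R) : (x ^+ 2) `^ (p / 2) = `|x| `^ p.
Proof.
rewrite -real_normK ?num_real // -powR_mulrn // -powRrM.
by congr (_ `^ _); field.
Qed.

Lemma trp_sq p n (H : 'M[C]_n) : \sum_i (eigs H i ^+ 2) `^ (p / 2) = trp p H.
Proof. by rewrite trp.unlock; apply: eq_bigr => i _; exact: abs_powR_sq. Qed.

Lemma mulmx_rdiagE m n (T : 'M[C]_(m, n)) lam i j :
  (T *m rdiag lam) i j = T i j * (lam j)%:C.
Proof. by rewrite mul_mx_diag mxE [X in _ * X]mxE. Qed.

Lemma mulmx_rdiag_ctrE m n (T : 'M[C]_(m, n)) lam i :
  (T *m rdiag lam *m ctr T) i i = (\sum_j lam j * sqn (T i j))%:C.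
Proof.
rewrite mxE rmorph_sum; apply: eq_bigr => j _.
by rewrite mulmx_rdiagE [ctr T j i]mxE mxE mulrAC mulCconjc -rmorphM mulrC.
Qed.

(* [powR 0] vanishes at positive exponents, so with [0^-1 = 0] the function
   [c |-> (c^-1) `^ (1 - s)] is a pseudo-inverse version of [c^(s-1)]. *)
Lemma rotfeld_powR_half n (P C V U : 'M[C]_n) (c q : 'I_n -> R) (s : R) : 0 < s -> s < 1 ->
  eigdec C V c -> eigdec P U q -> (forall j, 0 <= c j) -> (forall i, 0 <= q i) ->
  (forall z : 'rV[R[i]]_n, diagval z P 0 <= diagval z C 0) ->
  \sum_j diagval V P j * (c j)^-1 `^ (1 - s) <= \sum_i q i `^ s.
Proof.
move=> s0 s1 eC eP c0 q0 PC; have [V1 V2 _] := eC; have [U1 U2 _] := eP.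
(* Expanding [P] in its eigenbasis leaves one bound per eigenvector u_i: q_i g <= q_i^s, where [g]
   is the quadratic form of C^(s-1) at u_i. *)
under eq_bigr do rewrite (diagval_eig _ _ eP) mulr_suml.
rewrite exchange_big /=; apply: ler_sum => i _.
under eq_bigr do rewrite overlapC [_ * q i]mulrC -mulrA.
rewrite -mulr_sumr; set g := \sum_j _.
(* The quadratic form of the pseudo-inverse of [C] at u_i; concave Jensen will give g <= G^(1-s). *)
set G := \sum_j overlap U V i j * (c j)^-1.
have G0 : 0 <= G.
  by apply: sumr_ge0 => j _; rewrite mulr_ge0 ?overlap_ge0 // invr_ge0.
have gG : g <= G `^ (1 - s).
  apply: jensen_powR_concave; rewrite ?overlap_row //; try lra.
    by move=> j; exact: overlap_ge0.
  by move=> j; rewrite invr_ge0.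
have [->|qi] := eqVneq (q i) 0; first by rewrite mul0r powR_ge0.
have {}qi : 0 < q i by rewrite lt_neqAle eq_sym qi q0.
(* Test C >= q_i u_i u_i^* on the vector z = C^-1 u_i. *)
have key : q i * G ^+ 2 <= G.
  pose T := U *m ctr V; pose D := rdiag (fun j => (c j)^-1).
  pose z : 'rV[R[i]]_n := row i (T *m D *m V).
  have zV j : (z *m ctr V) 0 j = T i j * ((c j)^-1)%:C.
    by rewrite -row_mul -mulmxA V1 mulmx1 mxE mulmx_rdiagE.
  have zC : diagval z C 0 = G.
    rewrite (diagval_eig _ _ eC); apply: eq_bigr => j _.
    rewrite {1}/overlap zV [T i j * _]mulrC sqnM_real -/(overlap U V i j).
    have [->|cj] := eqVneq (c j) 0; first by rewrite invr0 !mulr0.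
    by field.
  have zU : (z *m ctr U) 0 i = G%:C.
    rewrite -row_mul mxE -[T *m D *m V *m _]mulmxA -[V *m _]ctrK ctrM ctrK mulmx_rdiag_ctrE.
    by congr (_%:C); apply: eq_bigr => j _; rewrite mulrC.
  rewrite -{2}zC; apply: le_trans (PC z); rewrite (diagval_eig _ _ eP) (bigD1 i) //=.
  rewrite /overlap zU sqn_real mulrC ler_wpDr //; apply: sumr_ge0 => k _.
  by rewrite mulr_ge0 ?overlap_ge0.
have Gq : G <= (q i)^-1.
  have [->|Gn] := eqVneq G 0; first by rewrite invr_ge0.
  have {}Gn : 0 < G by rewrite lt_neqAle eq_sym Gn.
  by rewrite -[leRHS]mul1r ler_pdivlMr // mulrC -(ler_pM2r Gn) -mulrA mul1r -expr2.
have -> : q i `^ s = q i * ((q i)^-1) `^ (1 - s).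
  rewrite -(powR_inv1 (ltW qi)) -powRrM mulN1r -[X in X * _](powRr1 (ltW qi)) -powRD.
    by congr (_ `^ _); ring.
  by rewrite (gt_eqF qi) implybT.
apply: ler_wpM2l => //; apply: le_trans gG _; apply: ler_powR2r => //; lra.
Qed.

(** With C = P + Q, the trace of C^s splits into those of P C^(s-1) and Q C^(s-1); [C] dominates
    both [P] and [Q], so the half-inequality bounds each. *)
Lemma rotfeld_powR n (P Q V U W : 'M[C]_n) (c q r : 'I_n -> R) (s : R) : 0 < s -> s < 1 ->
  eigdec (P + Q) V c -> eigdec P U q -> eigdec Q W r ->
  (forall m (z : 'M[C]_(m, n)) k, 0 <= diagval z P k) ->
  (forall m (z : 'M[C]_(m, n)) k, 0 <= diagval z Q k) ->
  \sum_j c j `^ s <= \sum_i q i `^ s + \sum_i r i `^ s.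
Proof.
move=> s0 s1 eC eP eQ P0 Q0.
have q0 i : 0 <= q i by rewrite -(diagval_self i eP).
have r0 i : 0 <= r i by rewrite -(diagval_self i eQ).
have c0 i : 0 <= c i by rewrite -(diagval_self i eC) diagvalD addr_ge0.
have cE j : c j `^ s = diagval V P j * (c j)^-1 `^ (1 - s) + diagval V Q j * (c j)^-1 `^ (1 - s).
  rewrite -mulrDl -diagvalD (diagval_self j eC).
  have [->|cj] := eqVneq (c j) 0; first by rewrite mul0r powR0 // gt_eqF.
  have {}cj : 0 < c j by rewrite lt_neqAle eq_sym cj c0.
  rewrite -(powR_inv1 (ltW cj)) -powRrM mulN1r -[X in X * _](powRr1 (ltW cj)) -powRD.
    by congr (_ `^ _); ring.
  by rewrite (gt_eqF cj) implybT.
under eq_bigr do rewrite cE.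
rewrite big_split /=; apply: lerD.
  by apply: (rotfeld_powR_half s0 s1 eC eP) => // z; rewrite diagvalD lerDl.
by apply: (rotfeld_powR_half s0 s1 eC eQ) => // z; rewrite diagvalD lerDr.
Qed.

Lemma clarkson_trp p n (H K : 'M[C]_n) : 1 <= p -> p < 2 -> herm H -> herm K ->
  trp p (H + K) + trp p (H - K) <= 2 * (trp p H + trp p K).
Proof.
move=> p1 p2 hH hK; set s := p / 2.
have s0 : 0 < s by rewrite /s; lra.
have s1 : s < 1 by rewrite /s; lra.
(* (H + K)^2 + (H - K)^2 = 2 G, and t |-> t^(p/2) is concave and subadditive under the trace. *)
pose G := H *m H + K *m K.
have hG : herm G by apply: hermD; exact: herm_sq.
have eG := eigsP hG; set V := spectralmx G in eG; have [V1 V2 _] := eG.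
have psd A (hA : herm A) m (z : 'M[C]_(m, n)) k : 0 <= diagval z (A *m A) k := sq_psd z k hA.
have hD := hermD hH hK; have hB := hermB hH hK.
have rot : \sum_j eigs G j `^ s <= trp p H + trp p K.
  rewrite -!trp_sq; apply: (rotfeld_powR s0 s1 eG (eigdec_sq (eigsP hH)) (eigdec_sq (eigsP hK))).
    exact: psd hH.
  exact: psd hK.
apply: le_trans (ler_wpM2l _ rot); last by [].
have GE j : 2 * eigs G j = diagval V ((H + K) *m (H + K)) j + diagval V ((H - K) *m (H - K)) j.
  rewrite -diagvalD -(diagval_self j eG) -diagvalZ; congr diagval.
  rewrite !(mulmxDl, mulmxDr, mulNmx, mulmxN) /G.
  move: (H *m K) (K *m H) (H *m H) (K *m K) => a b c d.
  rewrite (_ : 2%:C = 2) ?rmorph_nat // scaler_nat mulr2n.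
  by apply/matrixP => k l; rewrite !mxE; ring.
rewrite -!trp_sq.
(* By concavity, diagonal entries in the eigenbasis of [G] bound both traces on the left. *)
have := peierls_powR_concave (eigdec_sq (eigsP hD)) V1 V2 s0 (ltW s1) (fun j => sqr_ge0 _).
have := peierls_powR_concave (eigdec_sq (eigsP hB)) V1 V2 s0 (ltW s1) (fun j => sqr_ge0 _).
move=> hb hd; apply: le_trans (lerD hd hb) _.
rewrite -big_split /= mulr_sumr; apply: ler_sum => j _.
have := psd _ hD _ V j; have := psd _ hB _ V j; have := GE j.
move: (diagval V _ j) (diagval V _ j) (eigs G j) => y x g gE y0 x0.
(* Two-point Jensen with weights 1/2: x^s + y^s <= 2 g^s, since x + y = 2 g. *)
have w1 : \sum_(t : bool) (2^-1 : R) = 1 by rewrite big_bool /=; field.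
have := jensen_powR_concave s0 (ltW s1) (fun=> _) w1 (x := fun t : bool => if t then x else y).
rewrite !big_bool /= -!mulrDr -gE mulrA mulVf ?mul1r ?pnatr_eq0 //.
move=> /(_ _ _) h; rewrite -ler_pdivrMl //; apply: h => [_|[]] //.
by rewrite invr_ge0.
Qed.

End TracePowers.

(** * Second-order smoothness of the trace power for p >= 2 *)

Section SmoothnessAbove2.
Set Implicit Arguments. Unset Strict Implicit. Unset Printing Implicit Defensive.
Variable R : realType.
Local Notation C := R[i].
Local Notation "x %:C" := (real_complex R x).

(** The directional derivative of the trace power at [A] along [K], divided by p. *)
Definition dtrp (p : R) n (A K : 'M[C]_n) : R :=
  \sum_i spow (p - 1) (eigs A i) * diagval (spectralmx A) K i.

Lemma dtrp_sum p n (A : 'M[C]_n) I (r : seq I) (P : pred I) (w : I -> R) F :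
  dtrp p A (\sum_(j <- r | P j) (w j)%:C *: F j) = \sum_(j <- r | P j) w j * dtrp p A (F j).
Proof.
rewrite /dtrp; under eq_bigr do rewrite diagval_sum mulr_sumr.
rewrite exchange_big /=; apply: eq_bigr => j _; rewrite mulr_sumr.
by apply: eq_bigr => i _; rewrite diagvalZ mulrCA.
Qed.

(* Klein's double-basis expansion: for eigenbases (u_i) of A and (v_j) of B, both sides
   are averages over the weights |<u_i, v_j>|^2 of the scalar inequality. *)
Lemma bregman_trp p n (A B : 'M[C]_n) (a b D : R) : 2 <= p -> herm A -> herm B ->
  0 < a -> 0 < b -> 0 < D ->
  trp p A <= a `^ p -> trp p B <= b `^ p -> trp p (B - A) <= D `^ p ->
  trp p B <= trp p A + p * dtrp p A (B - A)
    + p * (p - 1) * ((b `^ (p - 2) + a `^ (p - 2)) * D ^+ 2).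
Proof.
move=> p2 hA hB a0 b0 D0 Aa Bb hD; have p1 : 1 <= p by lra.
have eA := eigsP hA; have eB := eigsP hB; have hK := hermB hB hA.
have [U1 U2 _] := eA; have [V1 V2 _] := eB.
set U := spectralmx A in eA U1 U2; set V := spectralmx B in eB V1 V2.
pose al := eigs A; pose be := eigs B; pose w := overlap U V.
have w0 i j : 0 <= w i j := overlap_ge0 U V i j.
have wr i : \sum_j w i j = 1 by exact: overlap_row.
have wc j : \sum_i w i j = 1 by exact: overlap_col.
have dU i : \sum_j w i j * (be j - al i) ^+ 2 = diagval U ((B - A) *m (B - A)) i.
  by rewrite (eigdec_diff i eA eB).
have dV j : \sum_i w i j * (be j - al i) ^+ 2 = diagval V ((B - A) *m (B - A)) j.
  have -> : (B - A) *m (B - A) = (A - B) *m (A - B).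
    by rewrite -[A - B]opprB mulmxN mulNmx opprK.
  rewrite (eigdec_diff j eB eA); apply: eq_bigr => i _.
  by rewrite /w overlapC -sqrrN opprB.
have Aa' : \sum_i `|al i| `^ p <= a `^ p by move: Aa; rewrite trp.unlock.
have Bb' : \sum_i `|be i| `^ p <= b `^ p by move: Bb; rewrite trp.unlock.
have EB : trp p B = \sum_i \sum_j w i j * `|be j| `^ p.
  by rewrite trp.unlock exchange_big /=; apply: eq_bigr => j _; rewrite -mulr_suml wc mul1r.
have EA : trp p A = \sum_i \sum_j w i j * `|al i| `^ p.
  by rewrite trp.unlock; apply: eq_bigr => i _; rewrite -mulr_suml wr mul1r.
have EL : p * dtrp p A (B - A) =
    \sum_i \sum_j w i j * (p * (spow (p - 1) (al i) * (be j - al i))).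
  rewrite /dtrp mulr_sumr; apply: eq_bigr => i _.
  rewrite diagvalB (diagval_self i eA) (diagval_eig _ _ eB) -/al -/be -/w.
  have -> : \sum_j w i j * be j - al i = \sum_j w i j * (be j - al i).
    by under [RHS]eq_bigr do rewrite mulrBr; rewrite sumrB -mulr_suml wr mul1r.
  rewrite !mulr_sumr; apply: eq_bigr => j _; ring.
(* Peierls with exponent p/2 >= 1 for the square of B - A. *)
have peiK (W : 'M[C]_n) : W *m ctr W = 1%:M -> ctr W *m W = 1%:M ->
    \sum_i diagval W ((B - A) *m (B - A)) i `^ (p / 2) <= D `^ p.
  move=> W1 W2; have p21 : 1 <= p / 2 by lra.
  apply: le_trans hD; rewrite -trp_sq.
  have := peierls_powR (eigdec_sq (eigsP hK)) W1 W2 p21.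
  under eq_bigr do rewrite (ger0_norm (sq_psd _ _ hK)).
  by under [X in _ <= X]eq_bigr do rewrite (ger0_norm (sqr_ge0 _)).
(* Summing over j leaves |al_i|^(p-2) against the diagonal of (B - A)^2, the two factors for
   Hölder. *)
have HA : \sum_i \sum_j w i j * ((be j - al i) ^+ 2 * `|al i| `^ (p - 2)) <=
    a `^ (p - 2) * D ^+ 2.
  under eq_bigr => i _ do under eq_bigr do rewrite mulrA mulrC.
  under eq_bigr => i _ do rewrite -mulr_sumr dU.
  apply: holder_powR => //; [move=> i; exact: sq_psd | exact: peiK].
have HB : \sum_i \sum_j w i j * ((be j - al i) ^+ 2 * `|be j| `^ (p - 2)) <=
    b `^ (p - 2) * D ^+ 2.
  rewrite exchange_big /=.
  under eq_bigr => i _ do under eq_bigr do rewrite mulrA mulrC.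
  under eq_bigr => i _ do rewrite -mulr_sumr dV.
  apply: holder_powR => //; [move=> i; exact: sq_psd | exact: peiK].
have pp : 0 <= p * (p - 1) by rewrite mulr_ge0 //; lra.
rewrite EB EA EL.
rewrite (mulrDl (b `^ (p - 2))).
apply: le_trans (lerD (lexx _) (ler_wpM2l pp (lerD HB HA))).
rewrite -!big_split /= mulr_sumr -big_split /=; apply: ler_sum => i _.
rewrite -!big_split /= mulr_sumr -big_split /=; apply: ler_sum => j _.
have := ler_wpM2l (w0 i j) (bregman_powR (be j) (al i) p2).
rewrite -/al -/be => /le_trans; apply; rewrite le_eqVlt; apply/orP; left; apply/eqP; ring.
Qed.

End SmoothnessAbove2.

(** * Singular values and the Hermitian dilation *)

Section HermitianDilation.
Set Implicit Arguments. Unset Strict Implicit. Unset Printing Implicit Defensive.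
Variable R : realType.
Local Notation C := R[i].
Local Notation "x %:C" := (real_complex R x).

Lemma char_poly_eigdec n (H V : 'M[C]_n) lam : eigdec H V lam ->
  char_poly H = \prod_(x <- [seq (lam i)%:C | i <- enum 'I_n]) ('X - x%:P).
Proof.
move=> [V1 V2 HE]; pose cV := map_mx (@polyC C) V; pose cW := map_mx (@polyC C) (ctr V).
have WV : cW *m cV = 1%:M by rewrite -map_mxM V2 map_mx1.
have -> : char_poly H = char_poly (rdiag lam).
  rewrite /char_poly; have -> : char_poly_mx H = cW *m char_poly_mx (rdiag lam) *m cV.
    rewrite /char_poly_mx {1}HE !map_mxM mulmxBr mulmxBl; congr (_ - _).
    by rewrite scalar_mxC -mulmxA WV mulmx1.
  by rewrite !det_mulmx mulrAC -det_mulmx WV det1 mul1r.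
rewrite char_poly_trig; last by apply/diag_mx_is_trig.
rewrite big_map big_enum /=; apply: eq_bigr => i _.
by rewrite !mxE eqxx mulr1n.
Qed.

(** Square roots of the eigenvalues of [adjmx A *m A] are a witness, so the choice in [sing_vals]
    never takes its default. *)
Lemma sing_valsP d (A : 'M[C]_d) : is_sing_vals A (sing_vals A).
Proof.
apply: xgetPex; have hA : herm (adjmx A *m A) by rewrite /herm ctrM [ctr (adjmx A)]ctrK.
have eA := eigsP hA.
exists [seq Num.sqrt (eigs (adjmx A *m A) i) | i <- enum 'I_d]; split.
- by rewrite size_map size_enum_ord.
- by apply/allP => _ /mapP[i _ ->]; exact: sqrtr_ge0.
rewrite (char_poly_eigdec eA) !big_map; apply: eq_bigr => i _.
rewrite sqr_sqrtr // -(diagval_self i eA).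
have -> : adjmx A *m A = adjmx A *m ctr (adjmx A) by rewrite [ctr (adjmx A)]ctrK.
by rewrite diagval_gram; apply: sumr_ge0 => j _; exact: sqn_ge0.
Qed.

Definition dil d (A : 'M[C]_d) : 'M[C]_(d + d) := block_mx 0 A (ctr A) 0.

Lemma dil_herm d (A : 'M[C]_d) : herm (dil A).
Proof.
rewrite /herm /ctr /dil map_block_mx tr_block_mx !map_mx0 !trmx0 -/(ctr A).
by rewrite -/(ctr (ctr A)) ctrK.
Qed.

Lemma dilD d (A B : 'M[C]_d) : dil (A + B) = dil A + dil B.
Proof. by rewrite /dil add_block_mx !addr0 ctrD. Qed.

Lemma dilZ d (x : R) (A : 'M[C]_d) : dil (x%:C *: A) = x%:C *: dil A.
Proof. by rewrite /dil scale_block_mx !scaler0 ctrZ. Qed.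

Lemma dilN d (A : 'M[C]_d) : dil (- A) = - dil A.
Proof. by rewrite /dil opp_block_mx !oppr0 ctrN. Qed.

Lemma dil_sum d I (r : seq I) (P : pred I) (F : I -> 'M[C]_d) :
  dil (\sum_(i <- r | P i) F i) = \sum_(i <- r | P i) dil (F i).
Proof.
apply: (big_morph (@dil d)) => [A B|]; first exact: dilD.
by have := dilZ 0 (0 : 'M[C]_d); rewrite !scale0r.
Qed.

(** The factor [T] clears the upper right block of the characteristic matrix, and its determinant,
    that of [x], cancels. *)
Lemma char_poly_dil d (A : 'M[C]_d) : char_poly (dil A) = char_poly (ctr A *m A) \Po 'X^2.
Proof.
pose x : 'M[{poly C}]_d := 'X%:M; pose B := map_mx (@polyC C) A.
pose B' := map_mx (@polyC C) (ctr A).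
have ME : char_poly_mx (dil A) = block_mx x (- B) (- B') x.
  rewrite /char_poly_mx /dil map_block_mx !map_mx0 scalar_mx_block opp_block_mx add_block_mx.
  by rewrite !oppr0 !addr0 !add0r.
pose T := block_mx 1%:M B 0 x.
have MT : char_poly_mx (dil A) *m T = block_mx x 0 (- B') (x *m x - B' *m B).
  rewrite ME mulmx_block !mulmx1 !mulmx0 !addr0; congr block_mx.
    by rewrite mulNmx /x scalar_mxC subrr.
  by rewrite mulNmx addrC.
have dx : \det x != 0 by rewrite det_scalar expf_neq0 // polyX_eq0.
apply: (mulIf dx).
have -> : \det x = \det T by rewrite det_ublock det1 mul1r.
rewrite -det_mulmx MT det_lblock det_ublock det1 mul1r mulrC; congr (_ * _).
rewrite -det_map_mx; congr (\det _).
rewrite /x -scalar_mxM -expr2 /B' /B -map_mxM; apply/matrixP => i j.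
rewrite !mxE rmorphB rmorphMn /= comp_polyX comp_polyC; done.
Qed.

(** Each X^2 - s^2 splits as (X - s)(X + s); comparing roots as multisets, every singular value is
    counted twice. *)
Lemma trp_dil (p : R) d (A : 'M[C]_d) : 1 <= p ->
  trp p (dil A) = 2 * \sum_(x <- sing_vals A) x `^ p.
Proof.
move=> p1; have [_ /allP s0 sE] := sing_valsP A.
have := char_poly_dil A; have -> : char_poly (ctr A *m A) = _ := sE.
rewrite (char_poly_eigdec (eigsP (dil_herm A))).
have -> : (\prod_(x <- sing_vals A) ('X - (real_complex R (x ^+ 2))%:P)) \Po 'X^2 =
    \prod_(x <- [seq x%:C | x <- sing_vals A ++ [seq - x | x <- sing_vals A]]) ('X - x%:P).
  rewrite rmorph_prod big_map big_cat /= big_map -big_split /=; apply: eq_bigr => x _.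
  rewrite rmorphB /= comp_polyX comp_polyC.
  by rewrite rmorphN polyCN opprK -subr_sqr !rmorphXn.
move=> /prod_XsubC_eq pe.
have -> : trp p (dil A) = \sum_(z <- [seq (eigs (dil A) i)%:C | i <- enum 'I_(d + d)])
    `|complex.Re z| `^ p by rewrite trp.unlock big_map big_enum.
rewrite (perm_big _ pe) big_map big_cat big_map /= mulr2n mulrDl !mul1r.
by congr (_ + _); apply: eq_big_seq => x xs; rewrite ?normrN ger0_norm // s0.
Qed.

Lemma schatten_dil (p : R) d (A : 'M[C]_d) : 1 <= p ->
  schatten p A = (trp p (dil A) / 2) `^ p^-1.
Proof. by move=> p1; rewrite trp_dil // mulrC mulKf ?pnatr_eq0. Qed.

End HermitianDilation.

HB.lock Definition nrm {R : realType} (p : R) {n : nat} (H : 'M[R[i]]_n) : R :=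
  trp p H `^ p^-1.

(** * The norm on Hermitian matrices and the greedy choice *)

Section GreedySelection.
Set Implicit Arguments. Unset Strict Implicit. Unset Printing Implicit Defensive.
Variable R : realType.
Local Notation C := R[i].
Local Notation "x %:C" := (real_complex R x).

Lemma nrm_ge0 p n (H : 'M[C]_n) : 0 <= nrm p H. Proof. by rewrite nrm.unlock powR_ge0. Qed.

Lemma nrm_powR p n (H : 'M[C]_n) : 1 <= p -> nrm p H `^ p = trp p H.
Proof. by move=> p1; rewrite nrm.unlock powRVK ?trp_ge0 // gt_eqF //; lra. Qed.

Lemma nrm_le p n (H : 'M[C]_n) x : 1 <= p -> 0 <= x -> (nrm p H <= x) = (trp p H <= x `^ p).
Proof.
move=> p1 x0; have p0 : 0 < p by lra.
apply/idP/idP => h.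
  by rewrite -nrm_powR //; apply: ler_powR2r h; rewrite ?nrm_ge0 // ltW.
rewrite nrm.unlock -(@powRKV _ p x) ?gt_eqF //; apply: ler_powR2r => //; last exact: trp_ge0.
by rewrite invr_ge0 ltW.
Qed.

Lemma nrmZ p n (x : R) (H : 'M[C]_n) : 1 <= p -> herm H -> nrm p (x%:C *: H) = `|x| * nrm p H.
Proof.
move=> p1 hH; rewrite nrm.unlock trpZ // powRM ?powR_ge0 ?trp_ge0 // powRKV //.
by rewrite gt_eqF //; lra.
Qed.

Lemma trp0 p n : 1 <= p -> trp p (0 : 'M[C]_n) = 0.
Proof.
move=> p1; have h0 : herm (0 : 'M[C]_n) by apply/matrixP => i j; rewrite !mxE rmorph0.
have := trpZ 0 p1 h0; rewrite scale0r => ->.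
by rewrite normr0 powR0 ?mul0r // gt_eqF //; lra.
Qed.

Lemma nrm0 p n : 1 <= p -> nrm p (0 : 'M[C]_n) = 0.
Proof. by move=> p1; rewrite nrm.unlock trp0 // powR0 ?invr_eq0 // gt_eqF //; lra. Qed.

Lemma nrmD p n (A B : 'M[C]_n) : 1 <= p -> herm A -> herm B ->
  nrm p (A + B) <= nrm p A + nrm p B.
Proof.
(* [trp_triangle] asks for positive bounds, so each norm is enlarged by e/2. *)
move=> p1 hA hB; apply/ler_addgt0Pr => e e0.
have a0 := nrm_ge0 p A; have b0 := nrm_ge0 p B.
have ge2 : 0 < e / 2 by rewrite divr_gt0.
rewrite {1}(splitr e) addrACA nrm_le //; last by rewrite !addr_ge0 // ltW.
by apply: trp_triangle; rewrite -?nrm_le ?lerDl ?ltr_wpDl // ?addr_ge0 // ltW.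
Qed.

(** Turns growth of p-th powers into growth of squares: the tangent of t^(p/2) at a^2 gives b^p -
    a^p >= (p/2) a^(p-2) (b^2 - a^2), and a^(p-2) cancels. *)
Lemma smooth_step (p a b D : R) : 2 <= p -> 0 < D -> 0 < a -> (p - 2) * D <= a ->
  a < b -> b <= a + D ->
  b `^ p <= a `^ p + p * (p - 1) * ((b `^ (p - 2) + a `^ (p - 2)) * D ^+ 2) ->
  b ^+ 2 <= a ^+ 2 + 2 * (p - 1) * (1 + expR 1) * D ^+ 2.
Proof.
move=> p2 D0 a0 aD ab bD h; have b0 := lt_trans a0 ab.
have p0 : 0 < p by lra.
have A0 := powR_gt0 (p - 2) a0.
have q1 : 1 <= p / 2 by lra.
have := powR_tangent q1 (sqr_ge0 b) (sqr_ge0 a).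
rewrite !abs_powR_sq !gtr0_norm //.
have -> : p / 2 - 1 = (p - 2) / 2 by field.
rewrite abs_powR_sq gtr0_norm // => t.
have aE : a `^ p = a ^+ 2 * a `^ (p - 2).
  rewrite -powR_mulrn ?(ltW a0) // -powRD; last by rewrite (gt_eqF a0) implybT.
  by congr (_ `^ _); ring.
(* As (p - 2) D <= a, (1 + D/a)^(p-2) <= exp((p-2) D/a) <= e; hence the constant 1 + e. *)
have be : b `^ (p - 2) <= expR 1 * a `^ (p - 2).
  have Da : 0 <= D / a by rewrite divr_ge0 // ltW.
  have le1 : b <= (1 + D / a) * a by rewrite mulrDl mul1r divfK ?gt_eqF.
  have p20 : 0 <= p - 2 by lra.
  apply: le_trans (ler_powR2r p20 (ltW b0) le1) _.
  rewrite powRM ?(ltW a0) //; last lra.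
  apply: ler_wpM2r; first exact: ltW.
  have := expR_ge1Dx (D / a) => /(ler_powR2r p20 _) le2.
  apply: le_trans (le2 _) _; first lra.
  by rewrite -expRM ler_expR mulrC mulrA ler_pdivrMr // mul1r.
have D20 : 0 <= D ^+ 2 by rewrite sqr_ge0.
have pp : 0 <= p * (p - 1) by rewrite mulr_ge0 //; lra.
have h2 : b `^ p <= a `^ p + p * (p - 1) * (((1 + expR 1) * a `^ (p - 2)) * D ^+ 2).
  apply: le_trans h _; rewrite lerD2l; apply: ler_wpM2l => //; apply: ler_wpM2r => //.
  by rewrite mulrDl mul1r addrC lerD2l.
have : (p / 2 * a `^ (p - 2)) * b ^+ 2 <=
  (p / 2 * a `^ (p - 2)) * (a ^+ 2 + 2 * (p - 1) * (1 + expR 1) * D ^+ 2).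
  move: t h2; rewrite aE.
  move: (a `^ (p - 2)) (b `^ p) (expR 1) => A B e t h2.
  have -> : p / 2 * A * (a ^+ 2 + 2 * (p - 1) * (1 + e) * D ^+ 2) =
    a ^+ 2 * A + p * (p - 1) * ((1 + e) * A * D ^+ 2) + (p - 2) / 2 * (a ^+ 2 * A) by field.
  have -> : p / 2 * A * b ^+ 2 = p / 2 * (b ^+ 2 * A) by ring.
  lra.
by rewrite ler_pM2l // mulr_gt0 // divr_gt0.
Qed.

Section Selection.
Variables (n : nat) (I : finType) (w : I -> R) (Y : I -> 'M[C]_n) (p D : R).
Hypotheses (w0 : forall i, 0 <= w i) (w1 : \sum_i w i = 1) (hY : forall i, herm (Y i)).
Hypotheses (centered : \sum_i (w i)%:C *: Y i = 0) (YD : forall i, nrm p (Y i) <= D).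
Hypothesis D0 : 0 <= D.

Let hsum (s : seq I) : herm (\sum_(i <- s) Y i). Proof. exact: herm_sum. Qed.

Lemma sum_scale_const (H : 'M[C]_n) : \sum_i (w i)%:C *: H = H.
Proof. by rewrite -scaler_suml -rmorph_sum w1 scale1r. Qed.

(** [H] is the mean of the H - Y_i, so by convexity the mean of Tr |H - Y_i|^p is at least Tr |H|^p;
    averaging Clarkson then bounds the mean of Tr |H + Y_i|^p by Tr |H|^p + 2 D^p. *)
Lemma selection_type_p k : 1 <= p -> p < 2 ->
  exists2 s : seq I, size s = k & trp p (\sum_(i <- s) Y i) <= 2 * k%:R * D `^ p.
Proof.
move=> p1 p2; elim: k => [|k [s sk hs]].
  by exists [::] => //; rewrite big_nil trp0 // mulr0 mul0r.
set H := \sum_(i <- s) Y i in hs.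
have [i hi] : exists i, trp p (H + Y i) <= 2 * k.+1%:R * D `^ p.
  apply: (ex_le_weighted_mean w0 w1).
  have lo : trp p H <= \sum_i w i * trp p (H - Y i).
    have hF i : herm (H - Y i) by apply: hermB => //; exact: hsum.
    have := trp_convex p1 w0 w1 hF.
    under eq_bigr do rewrite scalerBr.
    by rewrite sumrB centered subr0 sum_scale_const.
  have : \sum_i w i * trp p (H + Y i) <=
      \sum_i w i * (2 * (trp p H + D `^ p) - trp p (H - Y i)).
    apply: ler_sum => i _; apply: ler_wpM2l => //.
    have := clarkson_trp p1 p2 (hsum s) (hY i); rewrite -/H.
    have := YD i; rewrite nrm_le //; lra.
  under [X in _ <= X]eq_bigr do rewrite mulrBr.
  rewrite sumrB -mulr_suml w1 mul1r -(natr1 k).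
  by move: lo hs; set S1 := \sum_i _; set S2 := \sum_i _; set T := D `^ p; lra.
exists (i :: s); first by rewrite /= sk.
by rewrite big_cons addrC.
Qed.

(** A choice with nonpositive derivative makes the linear term of [bregman_trp] harmless;
    [smooth_step] then adds at most 2(p-1)(1+e) D^2 to the squared norm, and [Dp p] dominates this
    constant. *)
Lemma selection_type_2 k : 2 <= p ->
  exists2 s : seq I, size s = k & nrm p (\sum_(i <- s) Y i) ^+ 2 <= Dp p * k%:R * D ^+ 2.
Proof.
move=> p2; have p1 : 1 <= p by lra.
have e2 : 2 <= expR 1 :> R by have := @expR_ge1Dx R 1; lra.
have e8 : 1 + expR 1 <= expR 1 ^+ 4 :> R.
  rewrite [_ ^+ 4](exprM _ 2 2); move: (expR 1) e2 => e e2.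
  have h : 2 * e <= e ^+ 2 by nra.
  by nra.
have M1 : 2 * (p - 1) * (1 + expR 1) <= Dp p.
  by rewrite /Dp; apply: ler_wpM2l => //; lra.
have M2 : p - 1 <= Dp p by apply: le_trans M1; move: (expR 1) e2 => e e2; nra.
have M0 : 0 <= Dp p by lra.
(* The linear bound [k%:R * D] takes over while the norm is below (p - 2) D, where
   the second-order estimate is too weak. *)
suff [s sk [_ h]] : exists2 s : seq I, size s = k &
    nrm p (\sum_(i <- s) Y i) <= k%:R * D /\
    nrm p (\sum_(i <- s) Y i) ^+ 2 <= Dp p * k%:R * D ^+ 2 by exists s.
have D20 := sqr_ge0 D.
elim: k => [|k [s sk]].
  exists [::] => //; rewrite big_nil nrm0 //.
  by rewrite !(mulr0, mul0r) expr0n.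
set H := \sum_(i <- s) Y i => -[aD a2].
(* [dtrp] is linear in the direction, so its mean over the centered family is 0. *)
have [i hi] : exists i, dtrp p H (Y i) <= 0.
  apply: (ex_le_weighted_mean w0 w1).
  by rewrite -dtrp_sum centered -(sum_scale_const 0) dtrp_sum -mulr_suml w1 mul1r
     /dtrp big1 // => i _; rewrite /diagval mulmx0 mul0mx mxE mulr0.
exists (i :: s); first by rewrite /= sk.
rewrite big_cons addrC -/H.
have hH : herm H := hsum s.
have := nrmD p1 hH (hY i).
have := YD i.
have a0 := nrm_ge0 p H; have b0 := nrm_ge0 p (H + Y i).
have breg := @bregman_trp _ p n H (H + Y i) (nrm p H) (nrm p (H + Y i)) D p2 hH (hermD hH (hY i)).
move: breg; rewrite [H + Y i - H]addrC addKr -!nrm_powR //.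
set a := nrm p H in aD a2 a0 *; set b := nrm p (H + Y i) in b0 *.
move=> breg yD bay; have bD : b <= a + D by lra.
have bk : b <= k.+1%:R * D by rewrite -natr1 mulrDl mul1r; lra.
split=> //; have k0 : 0 <= k%:R :> R by [].
rewrite -natr1 mulrDr mulr1 mulrDl.
have [ba|ab] := leP b a.
  apply: (@le_trans _ _ (a ^+ 2)); first by rewrite ler_pXn2r ?nnegrE.
  by apply: le_trans a2 _; rewrite lerDl mulr_ge0.
have Dpos : 0 < D.
  rewrite lt_neqAle D0 andbT; apply/eqP => DE; move: bk; rewrite -DE mulr0; lra.
(* One factor b is at most (p - 1) D, the other at most (k + 1) D, and p - 1 <= [Dp p]. *)
have small : b <= (p - 1) * D -> b ^+ 2 <= Dp p * k%:R * D ^+ 2 + Dp p * D ^+ 2.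
  move=> bs; apply: (@le_trans _ _ (((p - 1) * D) * (k.+1%:R * D))).
    by rewrite expr2; apply: ler_pM.
  rewrite -mulrDl -{2}(mulr1 (Dp p)) -mulrDr natr1 mulrACA -expr2.
  by apply: ler_wpM2r => //; apply: ler_wpM2r.
(* If a = 0 or a < (p - 2) D, then b <= a + D <= (p - 1) D and [small] applies. *)
have [/lt_eqF an|] := ltP 0 a; last by move=> a0'; apply: small; nra.
have [ad|da] := leP ((p - 2) * D) a; last by apply: small; nra.
have apos : 0 < a by rewrite lt_neqAle a0 andbT an.
have step := smooth_step p2 Dpos apos ad ab bD.
apply: le_trans (step _) _.
  apply: le_trans (breg apos (lt_trans apos ab) Dpos (lexx _) (lexx _) _) _.
    by rewrite nrm_powR // -nrm_le.
  by rewrite lerD2r gerDl; apply: mulr_ge0_le0 => //; lra.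
by apply: lerD => //; apply: ler_wpM2r.
Qed.

End Selection.

End GreedySelection.

HB.lock Definition snorm {R : realType} (p : R) {d : nat} (A : 'M[R[i]]_d) : R :=
  schatten p A.

(** * From Schatten norms to the dilation, and the number of points *)

Section ApproximateCaratheodory.
Set Implicit Arguments. Unset Strict Implicit. Unset Printing Implicit Defensive.
Variable R : realType.
Local Notation C := R[i].
Local Notation "x %:C" := (real_complex R x).

Lemma schattenE : @schatten R = @snorm R.
Proof. by rewrite snorm.unlock. Qed.

Lemma nrm_dil (p : R) d (A : 'M[C]_d) : 1 <= p ->
  nrm p (dil A) = 2 `^ p^-1 * snorm p A.
Proof.
move=> p1; rewrite nrm.unlock snorm.unlock schatten_dil // -powRM ?divr_ge0 ?trp_ge0 //.
by rewrite mulrC divfK ?pnatr_eq0.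
Qed.

Lemma snorm_ge0 (p : R) d (A : 'M[C]_d) : 0 <= snorm p A.
Proof. by rewrite -schattenE; exact: powR_ge0. Qed.

Lemma snormB (p : R) d (A B : 'M[C]_d) : 1 <= p ->
  snorm p (A - B) <= snorm p A + snorm p B.
Proof.
move=> p1; have t0 : 0 < (2 : R) `^ p^-1 by exact: powR_gt0.
rewrite -(ler_pM2l t0) mulrDr -!nrm_dil // dilD dilN.
have dB := dil_herm B.
have -> : - dil B = (-1)%:C *: dil B by rewrite rmorphN scaleNr rmorph1 scale1r.
apply: le_trans (nrmD p1 (dil_herm A) (hermZ _ dB)) _.
by rewrite lerD2l nrmZ // normrN normr1 mul1r.
Qed.

(** Boundedness of [S] bounds the distances by M + M, so [sup] is a true upper bound. *)
Lemma le_diam (p : R) d (S : set 'M[C]_d) X Y : 1 <= p -> sbounded p S ->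
  S X -> S Y -> snorm p (X - Y) <= diam p S.
Proof.
move=> p1 [M SM] SX SY.
have {}SM Z : S Z -> snorm p Z <= M by rewrite -schattenE; exact: SM.
apply: ub_le_sup; last by exists X, Y; split=> //; rewrite schattenE.
exists (M + M) => _ [X' [Y' [SX' SY' ->]]]; rewrite schattenE.
by apply: le_trans (snormB _ _ p1) _; apply: lerD; exact: SM.
Qed.

Lemma nceil_ge (x : R) : x <= (nceil x)%:R.
Proof.
apply: le_trans (ceil_ge x) _.
apply: (@le_trans _ _ (`|Num.ceil x|%N%:R)); last by rewrite ler_nat leq_maxr.
by rewrite natr_absz ler_int ler_norm.
Qed.

Lemma nceil_gt0 (x : R) : 0 < (nceil x)%:R :> R.
Proof. by rewrite ltr0n leq_maxl. Qed.

Section Average.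
Variables (p : R) (d : nat) (S : set 'M[C]_d) (n : nat) (lam : 'I_n -> R) (X : 'I_n -> 'M[C]_d).
Hypotheses (p1 : 1 <= p) (bS : sbounded p S) (l0 : forall i, 0 <= lam i).
Hypotheses (l1 : \sum_i lam i = 1) (SX : forall i, S (X i)).
Let A := \sum_i (lam i)%:C *: X i.
Let Y i := dil (X i - A).

Lemma diam_ge0 : 0 <= diam p S.
Proof.
(* Applied to the zero function, the averaging lemma supplies an index, hence a point of [S]. *)
have [|i _] := @ex_le_weighted_mean _ _ lam (fun=> 0) 0 l0 l1.
  by rewrite big1 // => i _; rewrite mulr0.
exact: le_trans (snorm_ge0 p (X i - X i)) (le_diam p1 bS (SX i) (SX i)).
Qed.

Lemma centered_dil : \sum_i (lam i)%:C *: Y i = 0.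
Proof.
under eq_bigr do rewrite -dilZ scalerBr.
rewrite -dil_sum sumrB sum_scale_const // subrr.
by have := dilZ 0 (0 : 'M[C]_d); rewrite !scale0r.
Qed.

(** X_i - A is the weighted mean over j of X_i - X_j, so convexity carries over the diameter
    bound. *)
Lemma nrm_centered_le i : nrm p (Y i) <= 2 `^ p^-1 * diam p S.
Proof.
have t0 : 0 <= (2 : R) `^ p^-1 := powR_ge0 _ _.
have tD : 0 <= 2 `^ p^-1 * diam p S by rewrite mulr_ge0 ?diam_ge0.
rewrite nrm_le //.
have -> : Y i = \sum_j (lam j)%:C *: dil (X i - X j).
  under eq_bigr do rewrite -dilZ scalerBr.
  by rewrite -dil_sum sumrB sum_scale_const.
apply: le_trans (trp_convex p1 l0 l1 (fun j => dil_herm (X i - X j))) _.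
rewrite -[leRHS]mul1r -[X in _ <= X * _]l1 mulr_suml; apply: ler_sum => j _.
rewrite ler_wpM2l // -nrm_le // nrm_dil //.
by rewrite ler_wpM2l // le_diam.
Qed.

(** The error is -1/k times the sum of the k selected deviations; [s] may repeat indices. *)
Lemma approx_of_selection (eps : R) (s : seq 'I_n) : (0 < size s)%N ->
  nrm p (\sum_(i <- s) Y i) <= (size s)%:R * (2 `^ p^-1 * eps) ->
  approx_by_avg p S A eps (size s).
Proof.
move=> s0 h; exists (fun j => X (tnth (in_tuple s) j)); split=> [j|]; first exact: SX.
have k0 : 0 < (size s)%:R :> R by rewrite ltr0n.
have t0 : 0 < (2 : R) `^ p^-1 by exact: powR_gt0.
rewrite schattenE -(ler_pM2l t0) -nrm_dil //.
rewrite -(big_tnth _ _ s xpredT X).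
have -> : A - (size s)%:R^-1%:C *: (\sum_(i <- s) X i) =
   (- (size s)%:R^-1)%:C *: (\sum_(i <- s) (X i - A)).
  rewrite sumrB scalerBr rmorphN scaleNr scaleNr opprK addrC; congr (_ + _).
  rewrite big_const_seq count_predT iter_addr_0 -scaler_nat scalerA.
  by rewrite -(rmorph_nat (real_complex R)) -rmorphM mulVf ?scale1r // gt_eqF.
rewrite dilZ dil_sum nrmZ //; last by apply: herm_sum => i; exact: dil_herm.
by rewrite normrN gtr0_norm ?invr_gt0 // ler_pdivrMl.
Qed.

End Average.

(** With c = 2e^2/p^(1/p), raising the hypothesis to the power p - 1 gives c^p (D/eps)^p <= k^(p-1);
    then use c^p >= 2 and multiply by k eps^p. *)
Lemma Cp_bound (p D eps : R) (k : nat) : 1 < p -> p <= 4 / 3 -> 0 <= D -> 0 < eps ->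
  0 < k%:R :> R -> Cp p * (D / eps) `^ (p / (p - 1)) <= k%:R ->
  2 * k%:R * D `^ p <= (k%:R * eps) `^ p.
Proof.
move=> p1 p43 D0 e0 k0; rewrite /Cp.
have e2 : 2 <= expR 1 :> R by have := @expR_ge1Dx R 1; lra.
have p0 : 0 < p by lra.
have q0 : 0 < p - 1 by lra.
set c := 2 * expR 1 ^+ 2 / p `^ p^-1.
have c0 : 0 <= c by rewrite divr_ge0 ?powR_ge0 // mulr_ge0 // exprn_ge0 // expR_ge0.
have De0 : 0 <= D / eps by rewrite divr_ge0 // ltW.
rewrite -powRM // => h.
have cD0 : 0 <= c * (D / eps) by rewrite mulr_ge0.
have := ler_powR2r (ltW q0) (powR_ge0 _ _) h.
rewrite -powRrM divfK ?gt_eqF // powRM // => {}h.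
(* Here c^p = (2e^2)^p / p, and 2p <= 8/3 <= 2e^2 <= (2e^2)^p. *)
have cp : 2 <= c `^ p.
  rewrite /c -powR_inv1 ?powR_ge0 // powRM ?powR_ge0 //; last first.
    by rewrite mulr_ge0 // exprn_ge0 // expR_ge0.
  rewrite -!powRrM (_ : p^-1 * (-1 * p) = -1) ?powR_inv1 ?(ltW p0) //; last first.
    by field; rewrite gt_eqF.
  rewrite ler_pdivlMr //.
  have b8 : 8 <= 2 * expR 1 ^+ 2 :> R by move: (expR 1) e2 => e e2; nra.
  apply: (@le_trans _ _ (2 * expR 1 ^+ 2)); first lra.
  by apply: le1r_powR; lra.
have Dp0 := powR_ge0 (D / eps) p.
have h2 : 2 * (D / eps) `^ p <= k%:R `^ (p - 1).
  by apply: le_trans h; apply: ler_wpM2r.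
rewrite powRM ?(ltW k0) ?(ltW e0) // -(@mulr_powRB1 _ k%:R) ?(ltW k0) //.
have -> : D `^ p = (D / eps) `^ p * eps `^ p by rewrite -powRM ?(ltW e0) // divfK ?gt_eqF.
have -> : 2 * k%:R * ((D / eps) `^ p * eps `^ p) = k%:R * (2 * (D / eps) `^ p) * eps `^ p by ring.
by apply: ler_wpM2r; rewrite ?powR_ge0 //; apply: ler_wpM2l => //; exact: ltW.
Qed.

End ApproximateCaratheodory.

Theorem mainTheorem3 (R : realType) (p : R) (d : nat) (S : set 'M[R[i]]_d)
    (A : 'M[R[i]]_d) (eps : R) :
  1 < p -> sbounded p S -> conv S A -> 0 < eps ->
  (p <= 4 / 3 ->
     approx_by_avg p S A eps
       (nceil (Cp p * powR (diam p S / eps) (p / (p - 1))))) /\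
  (p = 2 \/ 4 <= p ->
     approx_by_avg p S A eps
       (nceil (Dp p * (diam p S / eps) ^+ 2))).
Proof.
move=> p1 bS [n [lam [X [l0 l1 SX ->]]]] e0; have p1' := ltW p1.
have D0 := diam_ge0 p1' bS l0 l1 SX.
have t0 : 0 < (2 : R) `^ p^-1 by exact: powR_gt0.
have tp : ((2 : R) `^ p^-1) `^ p = 2 by rewrite powRVK // gt_eqF //; lra.
have tD0 : 0 <= (2 : R) `^ p^-1 * diam p S by rewrite mulr_ge0 // ltW.
have cen := centered_dil X l1.
have YD := nrm_centered_le p1' bS l0 l1 SX.
have hY i : herm (dil (X i - \sum_i real_complex R (lam i) *: X i)) := dil_herm _.
split=> [p43|p24].
- set k := nceil _; have k0 : 0 < k%:R :> R := nceil_gt0 _.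
  have p2 : p < 2 by lra.
  have [s sk hs] := selection_type_p l0 l1 hY cen YD tD0 k p1' p2.
  rewrite -sk; apply: approx_of_selection => //; first by rewrite sk -(ltr0n R).
  have ke0 : 0 <= k%:R * (2 `^ p^-1 * eps) by rewrite !mulr_ge0 // ltW.
  rewrite sk nrm_le //; apply: le_trans hs _.
  (* The dilation factor 2^(1/p), raised to the power p, is 2 on both sides; [Cp_bound] remains. *)
  rewrite mulrCA !powRM ?mulr_ge0 ?(ltW t0) ?(ltW k0) ?(ltW e0) // tp.
  have := Cp_bound p1 p43 D0 e0 k0 (nceil_ge _).
  by rewrite powRM ?(ltW k0) ?(ltW e0) //; lra.
- set k := nceil _; have k0 : 0 < k%:R :> R := nceil_gt0 _.
  have p2 : 2 <= p by case: p24; lra.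
  have [s sk hs] := selection_type_2 l0 l1 hY cen YD tD0 k p2.
  rewrite -sk; apply: approx_of_selection => //; first by rewrite sk -(ltr0n R).
  have ke0 : 0 <= k%:R * (2 `^ p^-1 * eps) by rewrite !mulr_ge0 // ltW.
  (* Compare squares, as the selection bounds the squared norm; k times the squared dilation factor
     is common to both sides. *)
  rewrite sk -(ler_pXn2r (ltn0Sn 1)) ?nnegrE ?nrm_ge0 //; apply: le_trans hs _.
  have kD : Dp p * diam p S ^+ 2 <= k%:R * eps ^+ 2.
    by rewrite -ler_pdivrMr ?exprn_gt0 // -mulrA -expr_div_n nceil_ge.
  rewrite !exprMn.
  have -> : Dp p * k%:R * ((2 `^ p^-1) ^+ 2 * diam p S ^+ 2) =
    (k%:R * (2 `^ p^-1) ^+ 2) * (Dp p * diam p S ^+ 2) by ring.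
  have -> : k%:R ^+ 2 * ((2 `^ p^-1) ^+ 2 * eps ^+ 2) =
    (k%:R * (2 `^ p^-1) ^+ 2) * (k%:R * eps ^+ 2) by ring.
  by apply: ler_wpM2l => //; rewrite mulr_ge0 ?sqr_ge0 // ltW.
Qed.
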